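(* Let $m,n\geq k\geq 1$ be integers, and let $A,B\in\mathbb{R}^{m\times n}$. Then the interval hull $\mathbb{I}(A,B)$ is totally negative of order $k$ if and only if both matrices $C^+(A,B)$ and $C^-(A,B)$ are totally negative of order $k$.
   Context: A real matrix is totally negative of order $k$ if all its minors of order at most $k$ are negative. The interval hull of $A,B\in\mathbb{R}^{m\times n}$ is $$\mathbb{I}(A,B)=\{C\in\mathbb{R}^{m\times n}: c_{ij}=t_{ij}a_{ij}+(1-t_{ij})b_{ij},\ t_{ij}\in[0,1]\},$$ and it is called totally negative of order $k$ if every matrix in it is totally negative of order $k$. For $z\in\{\pm1\}^m$, $\tilde z\in\{\pm1\}^n$, let $D_z$ be the diagonal matrix whose $i$th diagonal entry is $z_i$, let $|M|$ denote the entrywise absolute value of a matrix $M$, and set $$I_{z,\tilde z}(A,B):=\frac{A+B}{2}-D_z\frac{|A-B|}{2}D_{\tilde z}.$$ Let $d^{[n]}:=(1,-1,\ldots,(-1)^{n-1})^T$. Then $C^{\pm}(A,B):=I_{d^{[m]},\,\pm d^{[n]}}(A,B)$. *)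

(* Defs.v *)
From HB Require Import structures.
From mathcomp Require Import all_boot all_order all_algebra.
From mathcomp Require Import classical_sets reals.

Set Implicit Arguments.
Unset Strict Implicit.
Unset Printing Implicit Defensive.

Import Order.TTheory GRing.Theory Num.Theory.
Local Open Scope ring_scope.
Local Open Scope classical_set_scope.

Section Definitions.

Variables (R : realType) (m n : nat).

Implicit Types A B C M : 'M[R]_(m, n).

Definition increasing_index (p q : nat) (f : 'I_p -> 'I_q) : Prop :=
  forall i j : 'I_p, (i < j)%N -> (f i < f j)%N.

Definition minor (p : nat) (f : 'I_p -> 'I_m) (g : 'I_p -> 'I_n) A : R :=
  \det (mxsub f g A).

(* Minors have order at least 1: the empty determinant equals 1 and must be
   excluded. *)
Definition totally_negative (k : nat) A : Prop :=
  forall (p : nat) (f : 'I_p -> 'I_m) (g : 'I_p -> 'I_n),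
    (1 <= p <= k)%N -> increasing_index f -> increasing_index g ->
    minor f g A < 0.

Definition interval_hull A B : set 'M[R]_(m, n) :=
  [set C | exists t : 'M[R]_(m, n),
     (forall i j, 0 <= t i j <= 1) /\
     (forall i j, C i j = t i j * A i j + (1 - t i j) * B i j)].

Definition set_totally_negative (k : nat) (S : set 'M[R]_(m, n)) : Prop :=
  forall C, S C -> totally_negative k C.

Definition abs_mx M : 'M[R]_(m, n) := map_mx (fun x : R => `|x|) M.

(* Total in z and z'; it is meant for vectors with entries in {1, -1}. *)
Definition vertex_mx (z : 'cV[R]_m) (z' : 'cV[R]_n) A B : 'M[R]_(m, n) :=
  2^-1 *: (A + B)
    - diag_mx z^T *m (2^-1 *: abs_mx (A - B)) *m diag_mx z'^T.

(* Indices start at 0, so the first entry is 1. *)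
Definition alt_sign (q : nat) : 'cV[R]_q := \col_(i < q) (-1) ^+ i.

Definition Cplus A B : 'M[R]_(m, n) :=
  vertex_mx (alt_sign m) (alt_sign n) A B.

Definition Cminus A B : 'M[R]_(m, n) :=
  vertex_mx (alt_sign m) (- alt_sign n) A B.

End Definitions.

(* Main.v *)
Require Import Defs.
From mathcomp Require Import all_boot all_order all_algebra.
From mathcomp Require Import classical_sets reals.
From mathcomp Require Import zify ring lra.

Set Implicit Arguments.
Unset Strict Implicit.
Unset Printing Implicit Defensive.

Import Order.TTheory GRing.Theory Num.Theory.
Local Open Scope ring_scope.

(** Order the matrices by the checkerboard order: X <= Y when
    (-1)^(i+j) x_ij <= (-1)^(i+j) y_ij for all i and j.  The interval hull of
    A and B lies in the checkerboard interval from C+ to C-, and C+ and C-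
    belong to the hull.  So the theorem says that total negativity of order k
    passes from the two ends of a checkerboard interval to every matrix in it
    ([totally_negative_between]).  This is proved for the minors of order p,
    by induction on p, for all matrices of the interval at once; an entry lies
    between the corresponding entries of C+ and C-, which settles p = 1.

    For a minor of order p > 1 on consecutive rows and consecutive columns, starting at row a
    and column b, the derivative with respect to the entry (i, j) is, up to the
    sign (-1)^(i+j+a+b), a minor of order p-1, which is negative by induction
    throughout the interval.  Hence (-1)^(a+b) times this minor decreases along
    the checkerboard order ([consecutive_minor_antimono]), and the minor is
    bounded above by its value at C+ or at C-, depending on the parity of a+b.

    On rows or columns that are not consecutive the signs no longer form a
    checkerboard, and a Fekete-type criterion takes over: when the minors of
    order p-1 have one strict sign, the consecutive minors of order p decide
    the sign of all minors of order p ([minor_sign_consecutive]).  It rests on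
    a three-term Pluecker relation ([three_term]) that writes a minor with a
    gap between its rows as a combination, with coefficients of one sign, of
    two minors whose rows span a shorter range. *)

(** * A three-term relation between maximal minors *)

Section ThreeTerm.
Variable R : comPzRingType.

(** Moving a row past others costs a sign; comparing Laplace expansions along
    that row avoids computing the sign of a cyclic permutation. *)
Lemma det_move_row (q : nat) (P Q : 'M[R]_q) (i j : 'I_q) :
  row i P = row j Q -> row' i P = row' j Q ->
  (-1) ^+ i * \det P = (-1) ^+ j * \det Q.
Proof.
move=> eqr eqr'; rewrite (expand_det_row P i) (expand_det_row Q j) !big_distrr /=.
apply: eq_bigr => c _; have /rowP/(_ c) := eqr; rewrite !mxE => ->.
have -> : cofactor Q j c
    = (-1) ^+ (j + c) * \det (row' i (col' c P)).
  congr (_ * \det _); apply/matrixP => a b.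
  by move/matrixP/(_ a (lift c b)): eqr'; rewrite !mxE.
rewrite /cofactor !exprD.
rewrite mulrCA [RHS]mulrCA; congr (_ * _); rewrite !mulrA -!expr2 !sqrr_sign //.
Qed.

(** The signed maximal minors of N form a left kernel vector of N: bordering N
    by the column N u, which depends on the columns of N, gives a singular
    matrix, and this is its expansion along that column. *)
Lemma det_rows_dependency (q : nat) (N : 'M[R]_(q.+1, q)) (u : 'cV[R]_q) :
  \sum_(a < q.+1) (-1) ^+ a * (N *m u) a 0 * \det (rowsub (lift a) N) = 0.
Proof.
pose c := N *m u; pose M : 'M[R]_(1 + q) := row_mx c N.
have detM0 : \det M = 0.
  (* T subtracts from the bordering column its expression N u in the others. *)
  pose T : 'M[R]_(1 + q) := block_mx 1%:M 0 (- u) 1%:M.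
  have -> : \det M = \det (M *m T).
    by rewrite det_mulmx det_lblock !det1 !mulr1.
  rewrite mul_row_block !mulmx1 mulmx0 mulmxN subrr add0r.
  rewrite (expand_det_col _ (lshift q ord0)) big1 // => a _.
  by rewrite row_mxEl mxE mul0r.
rewrite -[RHS]detM0 (expand_det_col _ (lshift q ord0)).
apply: eq_bigr => a _; rewrite row_mxEl /cofactor addn0 -mulrA mulrCA.
congr (_ * (_ * \det _)); apply/matrixP => i j; rewrite !mxE.
case: splitP => k /= jk.
  by exfalso; move: jk (ltn_ord k); rewrite /bump; lia.
by congr (N _ _); apply: val_inj; move: jk => [].
Qed.

(** Choose u in [det_rows_dependency] so that the entry of N u in row a is the
    minor, on the columns g, of row a followed by all rows other than 0, s and
    the last one.  A repeated row makes this vanish except for these three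
    values of a.  The alternating signs of the dependency cancel against those
    of sorting the rows, so all three terms come out with sign +1, which is
    what makes the relation usable for sign arguments. *)
Lemma three_term (q : nat) (N : 'M[R]_(q.+3, q.+2)) (g : 'I_q.+1 -> 'I_q.+2)
    (t : 'I_q.+1) (s := lift ord0 (lift ord_max t) : 'I_q.+3) :
  \det (mxsub (lift ord0 \o lift ord_max) g N) * \det (rowsub (lift s) N)
  = \det (mxsub (lift s \o lift ord_max) g N) * \det (rowsub (lift ord0) N)
  + \det (mxsub (lift s \o lift ord0) g N) * \det (rowsub (lift ord_max) N).
Proof.
pose mid : 'I_q.+1 -> 'I_q.+3 := lift ord0 \o lift ord_max.
pose P a : 'M[R]_q.+1 :=
  \matrix_(i, j)
    N (if unlift ord0 i is Some i' then mid (lift t i') else a) (g j).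
(* The cofactors along row 0 of P a do not depend on a. *)
pose u : 'cV[R]_q.+2 := \sum_j cofactor (P ord0) ord0 j *: delta_mx (g j) 0.
have Nu a : (N *m u) a 0 = \det (P a).
  rewrite /u mulmx_sumr summxE (expand_det_row _ ord0); apply: eq_bigr => j _.
  rewrite -scalemxAr mxE mulrC -colE !mxE unlift_none; congr (_ * (_ * \det _)).
  by apply/matrixP => i k; rewrite !mxE liftK.
have detP_mid i : \det (P (mid (lift t i))) = 0.
  apply: (determinant_alternate (i1 := ord0) (i2 := lift ord0 i)) => // j.
  by rewrite !mxE unlift_none liftK.
have P_s : \det (P s) = (-1) ^+ t * \det (mxsub mid g N).
  rewrite -[LHS]mul1r -(expr0 (-1)).
  apply: (@det_move_row _ _ _ ord0 t).
    by apply/rowP => j; rewrite !mxE unlift_none.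
  by apply/matrixP => i j; rewrite !mxE liftK.
have P_0 : \det (P ord0) = \det (mxsub (lift s \o lift ord_max) g N).
  congr (\det _); apply/matrixP => i j; rewrite !mxE; congr (N _ _).
  have ltt := ltn_ord t.
  case: unliftP => [[i' lti'] ->|->]; apply: val_inj => /=; rewrite /bump; lia.
have P_max : \det (P ord_max)
    = (-1) ^+ q * \det (mxsub (lift s \o lift ord0) g N).
  rewrite -[LHS]mul1r -(expr0 (-1)).
  apply: (@det_move_row _ _ _ ord0 ord_max).
    apply/rowP => j; rewrite !mxE unlift_none; congr (N _ _).
    by apply: val_inj; rewrite /= /bump; have := ltn_ord t; lia.
  apply/matrixP => i j; rewrite !mxE liftK; congr (N _ _).
  by apply: val_inj; rewrite /= /bump; have := ltn_ord t; case: i => i lti /=; lia.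
have := det_rows_dependency N u.
rewrite (bigD1 ord0) // (bigD1 ord_max) //= (bigD1 s) /=; last first.
  by rewrite -!val_eqE /= /bump; have := ltn_ord t; lia.
rewrite big1 ?addr0 => [|a /andP[/andP[a0 amax] as_]]; last first.
  have [a1 Da|Da] := unliftP ord0 a; last by rewrite Da eqxx in a0.
  have [a2 Da1|Da1] := unliftP ord_max a1; last first.
    by rewrite Da Da1 -val_eqE /= /bump leq0n eqxx in amax.
  have [a3 Da2|Da2] := unliftP t a2; last by rewrite Da Da1 Da2 eqxx in as_.
  by rewrite Nu Da Da1 Da2 detP_mid mulr0 mul0r.
rewrite !Nu P_0 P_s P_max /= expr0 mul1r.
have -> : bump 0 (bump q.+1 t) = t.+1 by rewrite /bump; have := ltn_ord t; lia.
rewrite !mulrA -!exprD.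
have -> : (-1) ^+ (q.+2 + q) = 1 :> R.
  by rewrite -signr_odd; have -> : odd (q.+2 + q) = false by lia.
have -> : (-1) ^+ (t.+1 + t) = -1 :> R.
  by rewrite -signr_odd; have -> : odd (t.+1 + t) = true by lia.
rewrite mul1r mulN1r mulNr addrA => /eqP; by rewrite subr_eq0 => /eqP <-.
Qed.
End ThreeTerm.

(** * Consecutive minors decide the sign of all minors *)

Definition consecutive p q (f : 'I_p -> 'I_q) (a : nat) : Prop :=
  forall i, f i = (a + i)%N :> nat.

Lemma increasing_lift p q (h : 'I_p.+1 -> 'I_q) (a : 'I_p.+1) :
  increasing_index h -> increasing_index (h \o lift a).
Proof. by move=> hh [i lti] [j ltj] /= ij; apply: hh; rewrite /= /bump; lia. Qed.

Lemma consecutive_increasing p q (f : 'I_p -> 'I_q) a :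
  consecutive f a -> increasing_index f.
Proof. by move=> fa i j; rewrite !fa ltn_add2l. Qed.

Lemma consecutive_or_gap p q (f : 'I_p.+2 -> 'I_q) : increasing_index f ->
  (exists a, consecutive f a) \/
  exists t : 'I_p.+1, ((f (lift ord_max t)).+1 < f (lift ord0 t))%N.
Proof.
move=> ff; have [/existsP gap|/existsPn nogap] :=
  boolP [exists t : 'I_p.+1, ((f (lift ord_max t)).+1 < f (lift ord0 t))%N].
  by right.
left; exists (f ord0) => -[i lti]; elim: i lti => [|i IHi] lti.
  by rewrite addn0; congr (nat_of_ord (f _)); apply: val_inj.
have lti' : (i < p.+1)%N by lia.
have := nogap (Ordinal lti').
have -> : lift ord_max (Ordinal lti') = Ordinal (ltnW lti).
  by apply: val_inj; rewrite /= /bump; lia.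
have -> : lift ord0 (Ordinal lti') = Ordinal lti by apply: val_inj.
rewrite IHi /=; have := ff (Ordinal (ltnW lti)) (Ordinal lti) (ltnSn i).
rewrite IHi /=; lia.
Qed.

(** Filling a gap of f just after its entry number t gives the range h of rows
    to which [three_term] applies: the new index is strictly inside h. *)
Lemma insert_index p q (f : 'I_p.+2 -> 'I_q) (t : 'I_p.+1) :
  increasing_index f -> ((f (lift ord_max t)).+1 < f (lift ord0 t))%N ->
  exists2 h : 'I_p.+3 -> 'I_q,
    increasing_index h & h \o lift (lift ord0 (lift ord_max t)) =1 f.
Proof.
move=> ff gap; set s := lift ord0 _.
have vs : bump 0 (bump p.+1 t) = t.+1 by rewrite /bump; have := ltn_ord t; lia.
have ltr : ((f (lift ord_max t)).+1 < q)%N := ltn_trans gap (ltn_ord _).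
have fle (i j : 'I_p.+2) : (i <= j)%N -> (f i <= f j)%N.
  by rewrite leq_eqVlt => /predU1P[/val_inj->//|/ff/ltnW].
pose h a := if unlift s a is Some i then f i else Ordinal ltr.
exists h => [a b|i]; last by rewrite /= /h liftK.
rewrite /h; case: unliftP => [[i lti] ->|->]; case: unliftP => [[j ltj] ->|->] /=.
- by rewrite vs => ij; apply: ff; move: ij; rewrite /= /bump; lia.
- rewrite vs => ij; rewrite ltnS; apply: fle.
  by move: ij (ltn_ord t); rewrite /= /bump; lia.
- rewrite vs => ij; apply: (leq_trans gap); apply: fle.
  by move: ij; rewrite /= /bump; lia.
- by rewrite ltnn.
Qed.

Section ConsecutiveMinors.
Variables (R : realType) (q : nat) (e e' : R).

Lemma minor_eq m n p (f f' : 'I_p -> 'I_m) (g : 'I_p -> 'I_n) (C : 'M[R]_(m, n)) :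
  f =1 f' -> minor f g C = minor f' g C.
Proof.
by move=> ff'; congr (\det _); apply/matrixP => i j; rewrite !mxE ff'.
Qed.

Lemma minor_tr m n p (f : 'I_p -> 'I_m) (g : 'I_p -> 'I_n) (C : 'M[R]_(m, n)) :
  minor g f C^T = minor f g C.
Proof.
by rewrite /minor -det_tr; congr (\det _); apply/matrixP=> i j; rewrite !mxE.
Qed.

(** Induction on the spread of the rows, that is f ord_max - f ord0.  If f has
    a gap, insert an index r there; removing the first or the last index of the
    result decreases the spread, while removing r gives back f.  [three_term]
    relates the three minors, with coefficients of order one less that all have
    the sign of e. *)
Lemma minor_sign_rows m n (C : 'M[R]_(m, n)) (g : 'I_q.+2 -> 'I_n) :
  (forall (f : 'I_q.+1 -> 'I_m) (g' : 'I_q.+1 -> 'I_n),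
     increasing_index f -> increasing_index g' -> 0 < e * minor f g' C) ->
  increasing_index g ->
  (forall (f : 'I_q.+2 -> 'I_m) a, consecutive f a -> 0 < e' * minor f g C) ->
  forall f : 'I_q.+2 -> 'I_m, increasing_index f -> 0 < e' * minor f g C.
Proof.
move=> lower gg consec f.
have [d] := ubnP (f ord_max - f ord0)%N; elim: d f => // d IHd f ltd ff.
have [[a fa]|[t gap]] := consecutive_or_gap ff; first exact: consec fa.
have [h hh hf] := insert_index ff gap; set s := lift ord0 _ in hf.
have hmin : h ord0 = f ord0.
  by rewrite -hf /=; congr h; apply: val_inj; rewrite /= /bump.
have hmax : h ord_max = f ord_max.
  rewrite -hf /=; congr h; apply: val_inj => /=; rewrite /bump.
  by have := ltn_ord t; lia.
have low (a : 'I_q.+3) (b : 'I_q.+2) :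
    0 < e * minor (h \o (lift a \o lift b)) (g \o lift ord_max) C.
  apply: lower; last exact: increasing_lift.
  by have := increasing_lift b (increasing_lift a hh).
have X0 : 0 < e' * minor (h \o lift ord0) g C.
  apply: IHd; last exact: increasing_lift.
  have -> : (h \o lift ord0) ord_max = h ord_max.
    by congr h; apply: val_inj.
  have := hh ord0 (lift ord0 ord0) isT.
  have := ff ord0 ord_max isT.
  by move: ltd; rewrite hmax hmin /=; lia.
have Xmax : 0 < e' * minor (h \o lift ord_max) g C.
  apply: IHd; last exact: increasing_lift.
  have -> : (h \o lift ord_max) ord0 = h ord0.
    by congr h; apply: val_inj.
  have := hh (lift ord_max ord_max) ord_max.
  have := ff ord0 ord_max isT.
  by move: ltd; rewrite hmax hmin /= /bump; lia.
rewrite -(minor_eq g C hf).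
have three : minor (h \o (lift ord0 \o lift ord_max)) (g \o lift ord_max) C
      * minor (h \o lift s) g C
    = minor (h \o (lift s \o lift ord_max)) (g \o lift ord_max) C
      * minor (h \o lift ord0) g C
    + minor (h \o (lift s \o lift ord0)) (g \o lift ord_max) C
      * minor (h \o lift ord_max) g C.
  have := three_term (mxsub h g C) (lift ord_max) t.
  by cbv zeta; rewrite -/s -!mxsub_comp.
rewrite -(pmulr_rgt0 _ (low ord0 ord_max)) mulrACA three mulrDr.
by rewrite !(mulrACA e e'); apply: addr_gt0; apply: mulr_gt0.
Qed.

(** The row criterion is used twice: with consecutive columns, and then, on the
    transpose, with arbitrary rows. *)
Lemma minor_sign_consecutive m n (C : 'M[R]_(m, n)) :
  (forall (f : 'I_q.+1 -> 'I_m) (g : 'I_q.+1 -> 'I_n),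
     increasing_index f -> increasing_index g -> 0 < e * minor f g C) ->
  (forall (f : 'I_q.+2 -> 'I_m) (g : 'I_q.+2 -> 'I_n) a b,
     consecutive f a -> consecutive g b -> 0 < e' * minor f g C) ->
  forall (f : 'I_q.+2 -> 'I_m) (g : 'I_q.+2 -> 'I_n),
    increasing_index f -> increasing_index g -> 0 < e' * minor f g C.
Proof.
move=> lower consec f g ff gg; rewrite -minor_tr.
apply: minor_sign_rows => // [g' f' gg' ff'|g' b gb]; rewrite minor_tr.
  exact: lower.
apply: minor_sign_rows => // [|f' a fa]; first exact: consecutive_increasing gb.
exact: consec fa gb.
Qed.

End ConsecutiveMinors.

(** * Monotonicity in the checkerboard order *)

Section Checkerboard.
Variable R : realType.

Definition checker_le m n (X Y : 'M[R]_(m, n)) : Prop :=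
  forall (i : 'I_m) (j : 'I_n),
    (-1) ^+ (i + j) * X i j <= (-1) ^+ (i + j) * Y i j.

Lemma checker_le_trans m n (Y X Z : 'M[R]_(m, n)) :
  checker_le X Y -> checker_le Y Z -> checker_le X Z.
Proof. by move=> XY YZ i j; apply: le_trans (XY i j) (YZ i j). Qed.

(** X is changed into Y one row at a time.  Expanding along the row that
    changes, the cofactors are common to both matrices and are signed minors of
    order one less of a matrix Z between X and Y; as the rows and columns are
    consecutive, their signs agree with the checkerboard up to (-1)^(a+b). *)
Lemma consecutive_minor_antimono m n q (X Y : 'M[R]_(m, n))
    (f : 'I_q.+1 -> 'I_m) (g : 'I_q.+1 -> 'I_n) a b :
  consecutive f a -> consecutive g b -> checker_le X Y ->
  (forall Z, checker_le X Z -> checker_le Z Y ->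
     forall (f' : 'I_q -> 'I_m) (g' : 'I_q -> 'I_n),
       increasing_index f' -> increasing_index g' -> minor f' g' Z <= 0) ->
  (-1) ^+ (a + b) * minor f g Y <= (-1) ^+ (a + b) * minor f g X.
Proof.
move=> fa gb XY lower.
pose H s : 'M[R]_(m, n) :=
  \matrix_(i, j) if (i < a + s)%N then Y i j else X i j.
have XH s : checker_le X (H s) by move=> i j; rewrite !mxE; case: ifP.
have HY s : checker_le (H s) Y by move=> i j; rewrite !mxE; case: ifP.
have HX : minor f g X = minor f g (H 0%N).
  congr (\det _); apply/matrixP => i j.
  by rewrite !mxE fa ltn_add2l ltn0.
have -> : minor f g Y = minor f g (H q.+1).
  congr (\det _); apply/matrixP => i j.
  by rewrite !mxE fa ltn_add2l ltn_ord.
suff mono s : (s <= q.+1)%N ->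
    (-1) ^+ (a + b) * minor f g (H s) <= (-1) ^+ (a + b) * minor f g X.
  exact: mono.
elim: s => [|s IHs] lts; first by rewrite HX.
apply: le_trans {IHs}(IHs (ltnW lts)).
pose i0 := Ordinal lts.
rewrite /minor !(expand_det_row _ i0) !big_distrr /=; apply: ler_sum => j _.
have cofE s' : cofactor (mxsub f g (H s')) i0 j
    = (-1) ^+ (i0 + j) * minor (f \o lift i0) (g \o lift j) (H s').
  by congr (_ * \det _); apply/matrixP => i k; rewrite !mxE.
rewrite !cofE.
have -> : minor (f \o lift i0) (g \o lift j) (H s.+1)
    = minor (f \o lift i0) (g \o lift j) (H s).
  congr (\det _); apply/matrixP => i k; rewrite !mxE.
  have : lift i0 i != s :> nat by rewrite -[s]/(val i0) val_eqE eq_sym neq_lift.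
  rewrite fa !ltn_add2l => nes; congr (if _ then _ else _); lia.
set M := minor _ _ _; have M0 : M <= 0.
  by apply: lower => //; apply: increasing_lift;
    [apply: consecutive_increasing fa | apply: consecutive_increasing gb].
have signE x : (-1) ^+ (a + b) * (x * ((-1) ^+ (i0 + j) * M))
    = (-1) ^+ (f i0 + g j) * x * M.
  by rewrite fa gb !exprD; ring.
rewrite !signE; apply: ler_wnM2r => //.
rewrite !mxE fa !ltn_add2l /= ltnSn ltnn.
by have := XY (f i0) (g j); rewrite fa.
Qed.

(** The order 1 step is separate because the empty minor is 1, so that a minor
    of order 1 does not fall under [consecutive_minor_antimono]. *)
Lemma totally_negative_between m n k (L U X : 'M[R]_(m, n)) :
  totally_negative k L -> totally_negative k U ->
  checker_le L X -> checker_le X U -> totally_negative k X.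
Proof.
move=> tnL tnU LX XU p f g /andP[p0 pk] ff gg.
elim: p p0 pk f g ff gg X LX XU => // -[_ _ k0|q IHq _ qk] f g ff gg X LX XU.
  have := LX (f ord0) (g ord0); have := XU (f ord0) (g ord0).
  have := tnL 1%N f g k0 ff gg; have := tnU 1%N f g k0 ff gg.
  by rewrite /minor !det_mx11 !mxE -signr_odd; case: odd => /=; lra.
have {}IHq := IHq isT (ltnW qk).
rewrite -oppr_gt0 -mulN1r.
apply: (@minor_sign_consecutive _ _ (-1) (-1)) => //.
  by move=> f' g' ff' gg'; rewrite mulN1r oppr_gt0; apply: IHq.
move=> {ff gg} {}f {}g a b fa gb; rewrite mulN1r oppr_gt0.
have ff := consecutive_increasing fa; have gg := consecutive_increasing gb.
have [even|odd] := boolP (~~ odd (a + b)).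
  apply: le_lt_trans (tnL _ f g qk ff gg).
  have := consecutive_minor_antimono fa gb LX.
  rewrite -signr_odd (negbTE even) !mul1r; apply=> Z LZ ZX f' g' ff' gg'.
  by apply/ltW/IHq => //; apply: checker_le_trans ZX XU.
apply: le_lt_trans (tnU _ f g qk ff gg).
have := consecutive_minor_antimono fa gb XU.
rewrite -signr_odd (negbNE odd) !mulN1r lerN2; apply=> Z XZ ZU f' g' ff' gg'.
by apply/ltW/IHq => //; apply: checker_le_trans LX XZ.
Qed.

(** * The interval hull as a checkerboard interval *)

Variables (m n : nat) (A B : 'M[R]_(m, n)).

Lemma CplusE i j :
  Cplus A B i j = (A i j + B i j) / 2 - (-1) ^+ (i + j) * (`|A i j - B i j| / 2).
Proof.
rewrite /Cplus /vertex_mx mul_diag_mx mul_mx_diag !mxE exprD; ring.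
Qed.

Lemma CminusE i j :
  Cminus A B i j = (A i j + B i j) / 2 + (-1) ^+ (i + j) * (`|A i j - B i j| / 2).
Proof.
rewrite /Cminus /vertex_mx mul_diag_mx mul_mx_diag !mxE exprD; ring.
Qed.

Lemma interval_hull_vertex (C : 'M[R]_(m, n)) :
  (forall i j, C i j = A i j \/ C i j = B i j) -> interval_hull A B C.
Proof.
move=> CAB; exists (\matrix_(i, j) (C i j == A i j)%:R); split=> i j; rewrite mxE.
  by rewrite ler0n lern1 leq_b1.
have [->|neA] := eqVneq; first by rewrite mul1r subrr mul0r addr0.
by case: (CAB i j) neA => ->; rewrite ?eqxx // mul0r add0r subr0 mul1r.
Qed.

Lemma interval_hull_Cplus : interval_hull A B (Cplus A B).
Proof.
apply: interval_hull_vertex => i j; rewrite CplusE -signr_odd.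
by case: odd; case: (ger0P (A i j - B i j)) => _; [left|right|right|left]; lra.
Qed.

Lemma interval_hull_Cminus : interval_hull A B (Cminus A B).
Proof.
apply: interval_hull_vertex => i j; rewrite CminusE -signr_odd.
by case: odd; case: (ger0P (A i j - B i j)) => _; [right|left|left|right]; lra.
Qed.

Lemma interval_hull_checker_le (C : 'M[R]_(m, n)) : interval_hull A B C ->
  checker_le (Cplus A B) C /\ checker_le C (Cminus A B).
Proof.
move=> [t [t01 CE]].
(* C+ and C- differ from the midpoint by exactly the radius, up to sign. *)
suff rad i j : `|C i j - (A i j + B i j) / 2| <= `|A i j - B i j| / 2.
  split=> i j; have := rad i j; rewrite ler_norml => /andP[lo hi];
    rewrite ?CplusE ?CminusE -signr_odd; case: odd => /=; lra.
have /andP[t0 t1] := t01 i j.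
have -> : C i j - (A i j + B i j) / 2 = (2 * t i j - 1) * (A i j - B i j) / 2.
  by rewrite CE; field.
rewrite !normrM (ger0_norm (_ : 0 <= 2^-1)) ?invr_ge0 //.
rewrite ler_wpM2r ?invr_ge0 // ler_piMl //.
by rewrite ler_norml; lra.
Qed.

End Checkerboard.

Theorem theorem3 (R : realType) (m n k : nat) (hk : (1 <= k)%N)
    (hm : (k <= m)%N) (hn : (k <= n)%N) (A B : 'M[R]_(m, n)) :
  set_totally_negative k (interval_hull A B) <->
  totally_negative k (Cplus A B) /\ totally_negative k (Cminus A B).
Proof.
split=> [tn|[tnp tnm] C].
  by split; apply: tn; [apply: interval_hull_Cplus|apply: interval_hull_Cminus].
case/interval_hull_checker_le; exact: totally_negative_between.
Qed.
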